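(* Fix $\lambda\in(0,1)$ and an integer $d\ge2$. Let $G$ be a service distribution satisfying the standing assumptions (A1) and (A2) of the context, and suppose in addition that there exist $x_0>1/(\lambda d)$, $C_0<\infty$ and $\beta>d/(d-1)$ such that $$\bar G(x)\le C_0x^{-\beta}\qquad\text{for all }x\ge x_0.$$ Then the queue length distribution $(s_\ell^* )_{\ell\in\mathbb{N}}$ associated with any physical invariant state of the hydrodynamic equations with arrival rate $\lambda$ exhibits a doubly exponential decay, in the sense that there exists a constant $n_d=n_d(\beta)>0$ such that $$\liminf_{\ell\to\infty}\frac1\ell\log_d\log\Big(\frac1{s_\ell^*}\Big)\ge n_d.$$
   Context: Service distribution. (A1): $G$ is the cumulative distribution function of a distribution on $[0,\infty)$ with a density $g$ and mean $1$. Put $\bar G=1-G$, $L=\sup\{x\in[0,\infty):\bar G(x)>0\}$ and $h(x)=g(x)/\bar G(x)$ for $x\in[0,L)$. Notation. $\mathbb{N}=\{1,2,\dots\}$; $\log_d$ is the logarithm to base $d$; $\langle f,\mu\rangle=\int f\,d\mu$; $\mathbf 1$ is the constant function $1$; $\mathbb{C}_b[0,\infty)$ is the space of bounded continuous functions on $[0,\infty)$; $\mathbb{M}_{\le1}[0,L)$ is the space of sub-probability measures on $[0,L)$ (weak topology); $$\mathbb{S}=\{(\mu_\ell)_{\ell\in\mathbb{N}}\in\mathbb{M}_{\le1}[0,L)^{\mathbb{N}}:\langle f,\mu_\ell\rangle\ge\langle f,\mu_{\ell+1}\rangle\ \forall \ell\in\mathbb{N},\ \forall f\in\mathbb{C}_b[0,\infty),\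 f\ge0\};$$ $\mathbb{C}_{\mathbb{S}}[0,\infty)$ is the set of continuous $\mathbb{S}$-valued functions on $[0,\infty)$; $\mathfrak{P}_d(x,y)=\sum_{m=0}^{d-1}x^my^{d-1-m}$ (which equals $(x^d-y^d)/(x-y)$ when $x\ne y$). Hydrodynamic equations. Given $\lambda>0$ and $\nu(0)\in\mathbb{S}$, a function $\nu=(\nu_\ell(t);\ell\in\mathbb{N},t\ge0)\in\mathbb{C}_{\mathbb{S}}[0,\infty)$ solves the hydrodynamic equations associated with $(\lambda,\nu(0))$ if for every $t\ge0$: $\int_0^t\langle h,\nu_1(s)\rangle ds<\infty$; for every $\ell\in\mathbb{N}$, $\langle\mathbf 1,\nu_\ell(t)\rangle-\langle\mathbf 1,\nu_\ell(0)\rangle=D_{\ell+1}(t)+\int_0^t\langle\mathbf 1,\eta_\ell(s)\rangle ds-D_\ell(t)$; and for every $\ell\in\mathbb{N}$ and $f\in\mathbb{C}_b[0,\infty)$, $$\langle f,\nu_\ell(t)\rangle=\Big\langle f(\cdot+t)\tfrac{\bar G(\cdot+t)}{\bar G(\cdot)},\nu_\ell(0)\Big\rangle+\int_{[0,t]}f(t-s)\bar G(t-s)\,dD_{\ell+1}(s)+\int_0^t\Big\langle f(\cdot+t-s)\tfrac{\bar G(\cdot+t-s)}{\bar G(\cdot)},\eta_\ell(s)\Big\rangle ds,$$ where $D_\ell(t)=\int_0^t\langle h,\nu_\ell(s)\rangle ds$, $\eta_1(t)=\lambda(1-\langle\mathbf 1,\nu_1(t)\rangle^d)\delta_0$ and,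 for $\ell\ge2$, $\eta_\ell(t)=\lambda\mathfrak{P}_d(\langle\mathbf 1,\nu_{\ell-1}(t)\rangle,\langle\mathbf 1,\nu_\ell(t)\rangle)(\nu_{\ell-1}(t)-\nu_\ell(t))$. (A2): there exists a unique solution to the hydrodynamic equations (for each initial condition $\nu(0)\in\mathbb{S}$). Invariant states. $\nu^*\in\mathbb{S}$ is an invariant state of the hydrodynamic equations with arrival rate $\lambda$ if $\nu(t)=\nu^*$ for all $t\ge0$ solves the hydrodynamic equations associated with $(\lambda,\nu^* )$. For an invariant state put $s_\ell^*=\langle\mathbf 1,\nu_\ell^*\rangle$ (the associated queue length distribution). It is a physical invariant state if in addition $\lim_{\ell\to\infty}s_\ell^*=0$. *)

(* Defs.v *)
From HB Require Import structures.
From mathcomp Require Export all_boot all_order all_algebra.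
From mathcomp Require Export all_classical all_reals all_analysis.
Set Implicit Arguments.
Unset Strict Implicit.
Unset Printing Implicit Defensive.
Import Order.TTheory GRing.Theory Num.Theory.
Import numFieldTopology.Exports numFieldNormedType.Exports.
Local Open Scope classical_set_scope.
Local Open Scope ring_scope.

Definition service_distribution (R : realType) (G g : R -> R) : Prop :=
  [/\ measurable_fun [set: R] g,
      (forall x : R, 0 <= x -> 0 <= g x) &
      exists P : probability (measurableTypeR R) R,
        [/\ P `[0, +oo[%classic = 1%E,
            (forall x, (G x)%:E = P `]-oo, x]%classic),
            (forall A : set R, measurable A ->
               P A = (\int[@lebesgue_measure R]_(x in A `&` `[0%R, +oo[%classic) (g x)%:E)%E) &
            (\int[P]_(x in `[0%R, +oo[) x%:E)%E = 1%E]].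

Definition Gbar (R : realType) (G : R -> R) (x : R) : R := 1 - G x.

(* This is L; it may be +oo *)
Definition support_end (R : realType) (G : R -> R) : \bar R :=
  ereal_sup [set x%:E | x in [set x : R | 0 <= x /\ 0 < Gbar G x]].

(* [supp G] is the interval [0, L) *)
Definition supp (R : realType) (G : R -> R) : set R :=
  [set x : R | 0 <= x /\ (x%:E < support_end G)%E].

Definition hazard (R : realType) (G g : R -> R) (x : R) : R := g x / Gbar G x.

(* Bounded continuous functions on D. Functions are total on R; their values
   outside of D are irrelevant. *)
Definition Cb (R : realType) (D : set R) : set (R -> R) :=
  [set f : R -> R | {within D, continuous f} /\
                    exists M : R, forall x, D x -> `|f x| <= M].

(* A sequence (mu_l) indexed by l = 1, 2, ... is a function on nat whose value
   at 0 is never looked at. *)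
Definition mseq (R : realType) : Type :=
  nat -> subprobability (measurableTypeR R) R.

(* <f, mu> for a measure mu on [0, L) and a function f bounded on [0, L) *)
Definition pairing (R : realType) (G : R -> R) (f : R -> R)
    (mu : subprobability (measurableTypeR R) R) : R :=
  \int[mu]_(x in supp G) f x.

Definition mass (R : realType) (G : R -> R)
    (mu : subprobability (measurableTypeR R) R) : R :=
  pairing G (fun=> 1) mu.

(* A measure on [0, L) is a measure on R that does not charge the complement
   of [0, L). *)
Definition in_S (R : realType) (G : R -> R) (mu : mseq R) : Prop :=
  (forall l, (0 < l)%N -> mu l (~` supp G) = 0%E) /\
  (forall l, (0 < l)%N -> forall f, Cb `[0, +oo[%classic f ->
     (forall x : R, 0 <= x -> 0 <= f x) ->
     pairing G f (mu l.+1) <= pairing G f (mu l)).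

Definition mseq_eq (R : realType) (mu nu : mseq R) : Prop :=
  forall l, (0 < l)%N -> forall A : set R, measurable A -> mu l A = nu l A.

(* S carries the product of the weak topologies, i.e. the initial topology of
   the maps mu |-> <f, mu_l> for l >= 1 and f in C_b[0, L). *)
Definition in_CS (R : realType) (G : R -> R) (nu : R -> mseq R) : Prop :=
  (forall t : R, 0 <= t -> in_S G (nu t)) /\
  (forall l, (0 < l)%N -> forall f, Cb (supp G) f ->
     {within `[0, +oo[%classic, continuous (fun t : R => pairing G f (nu t l))}).

Definition Pd (R : realType) (d : nat) (x y : R) : R :=
  \sum_(m < d) x ^+ m * y ^+ (d.-1 - m).

Definition departures (R : realType) (G g : R -> R) (nu : R -> mseq R) (l : nat) (t : R)
    : \bar R :=
  (\int[@lebesgue_measure R]_(s in `[0%R, t])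
     \int[nu s l]_(x in supp G) (hazard G g x)%:E)%E.

(* <f, eta_l> at a time where the state is mu; for l >= 2, eta_l is the signed
   combination lambda Pd(..) (mu_(l-1) - mu_l) of finite measures. *)
Definition pair_eta (R : realType) (G : R -> R) (d : nat) (lambda : R)
    (mu : mseq R) (l : nat) (f : R -> R) : R :=
  if (l <= 1)%N then lambda * (1 - mass G (mu 1%N) ^+ d) * f 0
  else lambda * Pd d (mass G (mu l.-1)) (mass G (mu l))
         * (pairing G f (mu l.-1) - pairing G f (mu l)).

(* x |-> f(x + u) Gbar(x + u) / Gbar(x) *)
Definition aged (R : realType) (G f : R -> R) (u x : R) : R :=
  f (x + u) * Gbar G (x + u) / Gbar G x.

(* On S one has D_l <= D_1 for all l >= 1, so under the first condition every
   D_l(t) is finite and [fine] loses nothing. Then D_l, extended by 0 to the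
   negative half-line, is nondecreasing and right-continuous: it is the unique
   cumulative function F below, and the integral against dD_(l+1) is the
   integral for the Lebesgue-Stieltjes measure of F. *)
Definition hydro_solution (R : realType) (G g : R -> R) (d : nat) (lambda : R)
    (nu0 : mseq R) (nu : R -> mseq R) : Prop :=
  [/\ in_CS G nu,
      mseq_eq (nu 0) nu0,
      (forall t : R, 0 <= t -> (departures G g nu 1 t < +oo)%E),
      (forall l, (0 < l)%N -> forall t : R, 0 <= t ->
         mass G (nu t l) - mass G (nu0 l) =
           fine (departures G g nu l.+1 t)
           + \int[@lebesgue_measure R]_(s in `[0, t])
               pair_eta G d lambda (nu s) l (fun=> 1)
           - fine (departures G g nu l t)) &
      (forall l, (0 < l)%N -> exists F : cumulative R R,
         (forall t : R, F t = fine (departures G g nu l.+1 (Num.max t 0))) /\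
         (forall t : R, 0 <= t -> forall f, Cb `[0, +oo[%classic f ->
            pairing G f (nu t l) =
              pairing G (aged G f t) (nu0 l)
              + \int[lebesgue_stieltjes_measure F]_(s in `[0, t])
                  (f (t - s) * Gbar G (t - s))
              + \int[@lebesgue_measure R]_(s in `[0, t])
                  pair_eta G d lambda (nu s) l (aged G f (t - s))))].

Definition hydro_well_posed (R : realType) (G g : R -> R) (d : nat)
    (lambda : R) : Prop :=
  forall nu0 : mseq R, in_S G nu0 ->
    exists nu : R -> mseq R, hydro_solution G g d lambda nu0 nu /\
      forall nu' : R -> mseq R, hydro_solution G g d lambda nu0 nu' ->
        forall t : R, 0 <= t -> mseq_eq (nu' t) (nu t).

Definition invariant_state (R : realType) (G g : R -> R) (d : nat)
    (lambda : R) (nu : mseq R) : Prop :=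
  in_S G nu /\ hydro_solution G g d lambda nu (fun=> nu).

Definition queue_length (R : realType) (G : R -> R) (nu : mseq R) (l : nat) : R :=
  mass G (nu l).

Definition physical_invariant_state (R : realType) (G g : R -> R) (d : nat)
    (lambda : R) (nu : mseq R) : Prop :=
  invariant_state G g d lambda nu /\ queue_length G nu l @[l --> \oo] --> 0.

Definition logb (R : realType) (b x : R) : R := ln x / ln b.

(* Main.v *)
Require Import Defs.
From mathcomp Require Import measurable_realfun ring lra.
Import Order.TTheory GRing.Theory Num.Theory.
Import numFieldTopology.Exports numFieldNormedType.Exports.
Local Open Scope classical_set_scope.
Local Open Scope ring_scope.

(** Write [A_t(x) = Gbar(x + t) / Gbar(x)] and [a_l(t) = <A_t, nu_l>]. In an
    invariant state the departure rates [H_l = <h, nu_l>] are constant in time,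
    and the mass equations telescope to [H_(l+1) = lambda s_l^d] since [s_l -> 0].
    Testing the renewal equation for [nu_l] against [f = 1] bounds
    [s_l - a_l(t)] by [t (H_(l+1) + c_l s_(l-1))] with [c_l <= lambda d s_(l-1)^(d-1)],
    that is by a multiple of [t s_(l-1)^d]. Testing the equation for [nu_1] against
    [f = A_t] gives [a_1(t) - a_1(2t) = O(t Gbar(t))], and summing over dyadic times
    yields [a_l(t) <= a_1(t) = O(t^(1 - beta))]. The choice [t = s_(l-1)^(- d / beta)]
    balances the two bounds: [s_l = O(s_(l-1)^kappa)] with [kappa = d (1 - 1 / beta)],
    and [kappa > 1] is exactly the assumption [beta > d / (d - 1)]. One may thus take
    [n_d = log_d kappa]. *)

(** Boundedness on a set of finite measure gives integrability; [m] and [M] may have any sign, hence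
    the larger of their absolute values as bound. *)
Lemma Rintegral_bounds (d : measure_display) (T : measurableType d) (R : realType)
    (mu : {measure set T -> \bar R}) (D : set T) (f : T -> R) (m M : R) :
  measurable D -> (mu D < +oo)%E -> measurable_fun D f ->
  (forall x, D x -> m <= f x <= M) ->
  m * fine (mu D) <= \int[mu]_(x in D) f x <= M * fine (mu D).
Proof.
move=> mD muD mf fb.
have cstI k : mu.-integrable D (EFin \o (fun=> k)).
  apply: measurable_bounded_integrable => //.
  exists `|k|; split; first exact: num_real.
  by move=> M' kM' y _; exact: ltW.
have fI : mu.-integrable D (EFin \o f).
  apply: measurable_bounded_integrable => //.
  exists (Num.max `|m| `|M|); split; first exact: num_real.
  move=> M' kM' y Dy; apply/ltW/(le_lt_trans _ kM').
  have /andP[] := fb _ Dy; rewrite le_max; case: (lerP 0 (f y)) => fy0 mf' fM.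
    by rewrite ger0_norm// (ger0_norm (le_trans fy0 fM)) fM orbT.
  by rewrite ltr0_norm// (ltr0_norm (le_lt_trans mf' fy0)) lerN2 mf'.
rewrite -!Rintegral_cst//; apply/andP; split; apply: le_Rintegral => // x Dx.
- by have /andP[] := fb _ Dx.
- by have /andP[] := fb _ Dx.
Qed.

(** * Regularity of the survival function and of the aging factor *)

Section service.
Variables (R : realType) (G g : R -> R).
Hypothesis GS : service_distribution G g.

Lemma Gbar_ge0 x : 0 <= Gbar G x.
Proof.
have [_ _ [P [_ GP _ _]]] := GS.
by rewrite subr_ge0 -lee_fin GP probability_le1.
Qed.

Lemma Gbar_le1 x : Gbar G x <= 1.
Proof.
have [_ _ [P [_ GP _ _]]] := GS.
by rewrite lerBlDr lerDl -lee_fin GP measure_ge0.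
Qed.

Lemma Gbar_noninc : nonincreasing_fun (Gbar G).
Proof.
move=> x y xy; have [_ _ [P [_ GP _ _]]] := GS.
rewrite lerB// -lee_fin !GP le_measure ?inE//.
by apply: subset_itvl; rewrite bnd_simp.
Qed.

(** Serves continuity: a finite lower endpoint left of 0 leaves an integral over a compact interval
    with moving upper endpoint, and cutting [g] off at 0 discards the values whose sign is
    unknown. *)
Lemma cdfE (a x : R) : a < 0 ->
  (G x)%:E = (\int[@lebesgue_measure R]_(y in `[a, x])
     ((g \_ `[0%R, +oo[%classic) y)%:E)%E.
Proof.
move=> a0; have [mg g0 [P [_ GP Pg _]]] := GS.
rewrite GP Pg//; transitivity (\int[@lebesgue_measure R]_(y in `[a, x] `&` `[0%R, +oo[)
    (g y)%:E)%E; last first.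
  by rewrite integral_mkcondr; under eq_integral do rewrite restrict_EFin.
congr (\int[_]_(y in _) _)%E.
apply/seteqP; split => y /=; rewrite !in_itv/= ?andbT => -[yx y0]; split => //.
- by rewrite yx (le_trans (ltW a0) y0).
- by case/andP : yx.
Qed.

Lemma Gbar_continuous : continuous (Gbar G).
Proof.
have [mg g0 [P [_ GP Pg _]]] := GS.
have mg' D : measurable D -> measurable_fun D (g \_ `[0%R, +oo[%classic).
  move=> mD; apply/measurable_restrict => //.
  exact: measurable_funS mg.
move=> x; apply: cvgB; first exact: cvg_cst.
pose a : R := - `|x| - 1; pose b : R := `|x| + 1.
have a0 : a < 0 by rewrite /a -opprD oppr_lt0 ltr_wpDl.
have ax : a < x by rewrite /a ltrBlDr (le_lt_trans (_ : - `|x| <= x))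
  ?lerNnormlW ?ltrDl// lerNl -normrN ler_norm.
have xb : x < b by rewrite /b (le_lt_trans (ler_norm x))// ltrDl.
have ab : a < b by exact: lt_trans xb.
have gI : (@lebesgue_measure R).-integrable `[a, b]
    (EFin \o (g \_ `[0%R, +oo[%classic)).
  apply/integrableP; split; first by apply/measurable_EFinP; exact: mg'.
  rewrite [ltLHS](_ : _ = (G b)%:E) ?ltry// (cdfE _ b a0).
  apply: eq_integral => y _ /=; rewrite ger0_norm//.
  by rewrite /patch; case: ifPn => //; rewrite inE/= in_itv/= andbT; exact: g0.
suff : {within `[a, b], continuous G}.
  move/within_continuous_continuous => /(_ x ab); apply.
  by rewrite in_itv/= ax xb.
have := parameterized_integral_continuous (ltW ab) gI.
apply: subspace_eq_continuous => y _ /=.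
by rewrite -[RHS]/(fine (G y)%:E) (cdfE _ y a0).
Qed.

Lemma Gbar0 : Gbar G 0 = 1.
Proof.
rewrite /Gbar; suff -> : G 0 = 0 by rewrite subr0.
apply: EFin_inj; have [mg g0 [P [_ GP Pg _]]] := GS.
rewrite GP Pg//; have -> : `]-oo, 0%R] `&` `[0%R, +oo[ = [set (0:R)].
  apply/seteqP; split => y /=; rewrite !in_itv/= ?andbT.
    by case=> y0 y0'; apply/eqP; rewrite eq_le y0 y0'.
  by move=> ->.
by rewrite integral_set1.
Qed.

Lemma Gbar_cvg0 : Gbar G n%:R @[n --> \oo] --> 0.
Proof.
have [mg g0 [P [_ GP Pg _]]] := GS.
rewrite -(subrr 1); apply: cvgB; first exact: cvg_cst.
rewrite (_ : (fun n => G n%:R) = fine \o (fun n => (G n%:R)%:E)) //.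
apply: fine_cvg.
suff : (P `]-oo, n%:R]%classic @[n --> \oo] --> P (\bigcup_n `]-oo, n%:R]%classic))%E.
  rewrite (_ : \bigcup_n _ = setT) ?probability_setT.
    by apply: cvg_trans; apply: near_eq_cvg; apply: nearW => n /=; rewrite GP.
  apply/seteqP; split => // x _; exists (Num.bound `|x|) => //=.
  by rewrite in_itv/= ltW// (le_lt_trans (ler_norm x))// archi_boundP.
apply: nondecreasing_cvg_mu => //; first exact: bigcupT_measurable.
move=> m n mn; apply/subsetPset; apply: subset_itvl.
by rewrite bnd_simp ler_nat.
Unshelve. all: by end_near. Qed.

(** Makes [A_t] an admissible test function. Where [Gbar G x = 0] the quotient is 0 by the
    convention on division, and it stays 0 for [y > x - t] because then [y + t > x]; this is where
    [0 < t] enters. *)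
Lemma aged1_continuous (t : R) : 0 < t -> continuous (aged G (fun=> 1) t).
Proof.
move=> t0 x; rewrite /aged.
have [Gx|Gx] := eqVneq (Gbar G x) 0.
  rewrite /continuous_at Gx invr0 mulr0.
  apply: cvg_near_cst; near=> y; suff -> : Gbar G (y + t) = 0 by rewrite mulr0 mul0r.
  apply/eqP; rewrite eq_le Gbar_ge0 andbT -Gx; apply: Gbar_noninc.
  rewrite -lerBlDr ltW//; near: y; apply: lt_nbhsr.
  by rewrite ltrBlDr ltrDl.
apply: cvgM; last by apply: cvgV => //; exact: Gbar_continuous.
under eq_fun do rewrite mul1r; rewrite mul1r.
apply: (@cvg_comp _ _ _ (fun y => y + t) (Gbar G)); last exact: Gbar_continuous.
by apply: cvgD; [exact: cvg_id|exact: cvg_cst].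
Unshelve. all: by end_near. Qed.

Lemma aged1_ge0 (t x : R) : 0 <= aged G (fun=> 1) t x.
Proof. by rewrite /aged mul1r divr_ge0// Gbar_ge0. Qed.

Lemma aged1_noninc (t u x : R) : t <= u ->
  aged G (fun=> 1) u x <= aged G (fun=> 1) t x.
Proof.
move=> tu; rewrite /aged !mul1r ler_pM// ?invr_ge0 ?Gbar_ge0//.
by apply: Gbar_noninc; rewrite lerD2l.
Qed.

Lemma aged1_le1 (t x : R) : 0 <= t -> aged G (fun=> 1) t x <= 1.
Proof.
move=> t0; rewrite /aged mul1r; have [->|Gx] := eqVneq (Gbar G x) 0.
  by rewrite invr0 mulr0.
rewrite ler_pdivrMr ?lt_def ?Gx ?Gbar_ge0// mul1r.
by apply: Gbar_noninc; rewrite lerDl.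
Qed.

Lemma aged1_Cb (t : R) : 0 < t -> Cb `[0, +oo[%classic (aged G (fun=> 1) t).
Proof.
move=> t0; split.
  exact/continuous_subspaceT/aged1_continuous.
by exists 1 => x _; rewrite ger0_norm ?aged1_ge0// aged1_le1// ltW.
Qed.

Lemma cst_Cb (D : set R) (k : R) : Cb D (fun=> k).
Proof.
split; last by exists `|k|.
by apply: continuous_subspaceT => x; exact: cvg_cst.
Qed.

(** Semigroup law of aging. [Gbar G (x + u)] cannot be cancelled when it is 0, but then
    [Gbar G (x + u + t)] is 0 too. *)
Lemma aged_aged1 (t u x : R) :
  0 <= t -> 0 <= u ->
  aged G (aged G (fun=> 1) t) u x = aged G (fun=> 1) (u + t) x.
Proof.
move=> t0 u0; rewrite /aged !mul1r addrA.
have [Gx|Gx] := eqVneq (Gbar G (x + u)) 0; last by rewrite divfK.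
suff -> : Gbar G (x + u + t) = 0 by rewrite !mul0r.
by apply/eqP; rewrite eq_le Gbar_ge0 andbT -Gx; apply: Gbar_noninc; rewrite lerDl.
Qed.

Lemma supp_Gbar (x : R) : supp G x -> 0 < Gbar G x.
Proof.
case=> x0 /ereal_sup_gt[_ [y [y0 Gy] <-]]; rewrite lte_fin => xy.
by apply: (lt_le_trans Gy); apply: Gbar_noninc; exact: ltW.
Qed.

Lemma measurable_supp : measurable (supp G).
Proof.
apply: is_interval_measurable => x y [x0 xL] [y0 yL] z /andP[xz zy].
by split; [exact: le_trans xz|apply: le_lt_trans yL; rewrite lee_fin].
Qed.

End service.

(* [F] is continuous, so the closed interval [0, t] carries no extra mass at 0. *)
Lemma lebesgue_stieltjes_pos_part (R : realType) (F : cumulative R R) (H : R) :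
  (forall t, F t = Num.max t 0 * H) ->
  forall t, 0 <= t -> (lebesgue_stieltjes_measure F `[0%R, t]%classic = (t * H)%:E)%E.
Proof.
move=> FH t t0.
have FE (x y : R) : x <= y ->
    (lebesgue_stieltjes_measure F `]x, y]%classic = (F y - F x)%:E)%E.
  move=> xy; rewrite /lebesgue_stieltjes_measure /measure_extension/=.
  rewrite measurable_mu_extE/=; last exact: is_ocitv.
  rewrite wlength_itv/= lte_fin; move: xy; rewrite le_eqVlt => /predU1P[->|xy].
    by rewrite ltxx subrr.
  by rewrite xy EFinB.
(* [[0, t]] lies between []0, t]] and []-1, t]], whose measures are explicit and agree since [F]
   vanishes left of 0. *)
apply/eqP; rewrite eq_le; apply/andP; split.
  apply: (@le_trans _ _ (lebesgue_stieltjes_measure F `]-1, t]%classic)).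
    apply: le_measure; rewrite ?inE//.
    by apply: subset_itvr; rewrite bnd_simp ltrN10.
  rewrite FE ?(le_trans (lerN10 R))// !FH max_l// max_r ?lerN10//.
  by rewrite mul0r subr0.
apply: (@le_trans _ _ (lebesgue_stieltjes_measure F `]0, t]%classic)).
  by rewrite FE// !FH max_l// max_l// mul0r subr0.
apply: le_measure; rewrite ?inE//.
by apply: subset_itvr; rewrite bnd_simp.
Qed.

Lemma lebesgue_measure_itv0 (R : realType) (t : R) : 0 <= t ->
  (@lebesgue_measure R `[0%R, t]%classic = t%:E)%E.
Proof.
move=> t0; rewrite lebesgue_measure_itv/= lte_fin; case: ltP => [_|t0'].
  by rewrite oppr0 adde0.
by congr EFin; apply/eqP; rewrite eq_le t0 t0'.
Qed.

(** * Aged masses of a fixed measure, and departures from a constant state *)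

Section pairing.
Variables (R : realType) (G g : R -> R).
Hypothesis GS : service_distribution G g.
Implicit Types (mu : subprobability (measurableTypeR R) R) (t u : R).

Lemma measurable_aged1 t : 0 <= t -> measurable_fun (supp G) (aged G (fun=> 1) t).
Proof.
rewrite le_eqVlt => /predU1P[<-|t0].
  apply: (eq_measurable_fun (fun=> 1 : R)) => // x; rewrite inE => Gx.
  by rewrite /aged addr0 mul1r divff// gt_eqF// (supp_Gbar _ _ _ GS).
apply: subspace_continuous_measurable_fun; first exact: measurable_supp.
by apply: continuous_subspaceT; exact: (aged1_continuous _ _ _ GS).
Qed.

Lemma measure_supp_lty mu : (mu (supp G) < +oo)%E.
Proof.
apply: (@le_lt_trans _ _ 1%E); last exact: ltry.
apply: le_trans (@sprobability_setT _ _ _ mu).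
by apply: le_measure; rewrite ?inE//; exact: measurable_supp.
Qed.

Lemma massE mu : mass G mu = fine (mu (supp G)).
Proof. by rewrite /mass /pairing Rintegral_cst ?mul1r//; exact: measurable_supp. Qed.

Lemma mass_ge0 mu : 0 <= mass G mu.
Proof. by rewrite massE fine_ge0. Qed.

Lemma mass_le1 mu : mass G mu <= 1.
Proof.
rewrite massE -lee_fin fineK; last by rewrite ge0_fin_numE// measure_supp_lty.
apply: le_trans (@sprobability_setT _ _ _ mu).
by apply: le_measure; rewrite ?inE//; exact: measurable_supp.
Qed.

Lemma pairing_aged1_bounds mu t : 0 <= t ->
  0 <= pairing G (aged G (fun=> 1) t) mu <= mass G mu.
Proof.
move=> t0; rewrite -[X in X <= _ <= _](mul0r (fine (mu (supp G)))).
rewrite massE -[X in _ <= _ <= X]mul1r; apply: Rintegral_bounds.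
- exact: measurable_supp.
- exact: measure_supp_lty.
- exact: measurable_aged1.
- by move=> x _; rewrite (aged1_ge0 _ _ _ GS) (aged1_le1 _ _ _ GS).
Qed.

Lemma aged1_integrable mu t : 0 <= t ->
  mu.-integrable (supp G) (EFin \o aged G (fun=> 1) t).
Proof.
move=> t0; apply: measurable_bounded_integrable => //.
- exact: measurable_supp.
- exact: measure_supp_lty.
- exact: measurable_aged1.
exists 1; split; first exact: num_real.
move=> M M1 x _; apply/ltW/(le_lt_trans _ M1).
by rewrite ger0_norm ?(aged1_ge0 _ _ _ GS)// (aged1_le1 _ _ _ GS).
Qed.

Lemma pairing_aged1_noninc mu t u : 0 <= t -> t <= u ->
  pairing G (aged G (fun=> 1) u) mu <= pairing G (aged G (fun=> 1) t) mu.
Proof.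
move=> t0 tu; apply: le_Rintegral.
- exact: measurable_supp.
- by apply: aged1_integrable; exact: le_trans tu.
- exact: aged1_integrable.
- by move=> x _; exact: (aged1_noninc _ _ _ GS).
Qed.

(** Monotonicity in [u] gives measurability. Truncating [t - u] at 0 makes the function monotone on
    the whole line and changes nothing on [[0, t]]. *)
Lemma pairing_aged1_measurable mu t :
  measurable_fun `[0%R, t]%classic
    (fun u => pairing G (aged G (fun=> 1) (t - u)) mu).
Proof.
apply: (@eq_measurable_fun _ _ _ _ _
  (fun u => pairing G (aged G (fun=> 1) (Num.max (t - u) 0)) mu)).
  by move=> u; rewrite inE/= in_itv/= => /andP[_ ut]; rewrite max_l// subr_ge0.
apply: nondecreasing_measurable => // u v uv.
apply: pairing_aged1_noninc; first by rewrite le_max lexx orbT.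
by rewrite ge_max !le_max lexx orbT andbT lerB.
Qed.

(** Dominated convergence with bound 1, since [Gbar] tends to 0 at infinity. It removes the
    remainder of the dyadic telescoping for [a_1]. *)
Lemma pairing_aged1_cvg0 mu t : 0 < t ->
  pairing G (aged G (fun=> 1) (2 ^+ n * t)) mu @[n --> \oo] --> 0.
Proof.
move=> t0; have T0 n : 0 <= 2 ^+ n * t by rewrite mulr_ge0 ?exprn_ge0// ltW.
rewrite /pairing /Rintegral.
apply: fine_cvg.
have [] := @dominated_convergence _ (measurableTypeR R) R mu (supp G)
  (measurable_supp _ G)
  (fun n x => (aged G (fun=> 1) (2 ^+ n * t) x)%:E) (cst 0%E) (cst 1%E).
- by move=> n; apply/measurable_EFinP; exact: measurable_aged1.
- exact: measurable_cst.
- apply: aeW => x Gx; apply: cvg_EFin; first exact: nearW.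
  rewrite /aged/=; under eq_fun do rewrite mul1r.
  rewrite -(mul0r (Gbar G x)^-1); apply: cvgM; last exact: cvg_cst.
  have x0 : 0 <= x by case: Gx.
  apply/cvgrPdist_le => e e0.
  have /cvgrPdist_le/(_ _ e0)[N _ NG] := Gbar_cvg0 _ _ _ GS.
  exists (Num.bound (N%:R / t)) => // n /= Nn.
  have nN : N%:R <= 2 ^+ n * t.
    rewrite -ler_pdivrMr// -natrX (le_trans (ltW (archi_boundP _)))//.
      by rewrite divr_ge0// ltW.
    by rewrite ler_nat (leq_trans Nn)// ltnW// ltn_expl.
  rewrite sub0r normrN ger0_norm; last exact: (Gbar_ge0 _ _ _ GS).
  apply: le_trans (NG N (leqnn _)); rewrite /= sub0r normrN ger0_norm;
    last exact: (Gbar_ge0 _ _ _ GS).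
  by apply: (Gbar_noninc _ _ _ GS); rewrite (le_trans nN)// lerDr.
- apply/integrableP; split; first exact: measurable_cst.
  under eq_integral do rewrite /= normr1.
  by rewrite integral_cst ?mul1e ?measure_supp_lty//; exact: measurable_supp.
- apply: aeW => x n _ /=; rewrite lee_fin ger0_norm; last exact: (aged1_ge0 _ _ _ GS).
  exact: (aged1_le1 _ _ _ GS).
- by rewrite integral0.
Qed.

(* When [<h, nu_l> = +oo], [fine] sends both sides to 0. *)
Lemma departures_cst nu l t : 0 <= t ->
  fine (departures G g (fun=> nu) l t) = t * fine (departures G g (fun=> nu) l 1).
Proof.
move=> t0; rewrite /departures/=.
set K := (\int[nu l]_(x in supp G) (hazard G g x)%:E)%E.
have KE v : 0 <= v -> (\int[@lebesgue_measure R]_(_ in `[0%R, v]) K = K * v%:E)%E.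
  move=> v0; rewrite -(lebesgue_measure_itv0 _ _ v0).
  exact: (integral_cst _ _ K).
rewrite !KE// mule1 {KE}.
case: K => [k| |].
- by rewrite -EFinM/= mulrC.
- move: t0; rewrite le_eqVlt => /predU1P[<-|t0]; first by rewrite mule0 mul0r.
  by rewrite gt0_mulye//= ?mulr0// lte_fin.
- move: t0; rewrite le_eqVlt => /predU1P[<-|t0]; first by rewrite mule0 mul0r.
  by rewrite gt0_mulNye//= ?mulr0// lte_fin.
Qed.

Lemma departures_ge0 nu l t : 0 <= fine (departures G g (fun=> nu) l t).
Proof.
apply: fine_ge0; apply: integral_ge0 => u _; apply: integral_ge0 => x Gx.
have [_ g0 _] := GS; rewrite lee_fin divr_ge0 ?g0 ?(Gbar_ge0 _ _ _ GS)//.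
by case: Gx.
Qed.

End pairing.

(** * The polynomial [Pd] *)

Lemma Pd_subX (R : realType) d (x y : R) : (0 < d)%N ->
  Pd d x y * (x - y) = x ^+ d - y ^+ d.
Proof.
case: d => // d _; rewrite subrXX mulrC; congr (_ * _).
rewrite [RHS](reindex_inj rev_ord_inj)/=.
apply: eq_bigr => i _; have id : (i <= d)%N by exact: (ltn_ord i).
by rewrite subSS (subKn id).
Qed.

Lemma Pd_ge0 (R : realType) d (x y : R) : 0 <= x -> 0 <= y -> 0 <= Pd d x y.
Proof. by move=> x0 y0; apply: sumr_ge0 => i _; rewrite mulr_ge0// exprn_ge0. Qed.

Lemma Pd_le (R : realType) d (x y : R) : 0 <= y -> y <= x ->
  Pd d x y <= d%:R * x ^+ d.-1.
Proof.
move=> y0 yx; have x0 : 0 <= x by exact: le_trans yx.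
rewrite -[X in X%:R]card_ord mulr_natl -sumr_const; apply: ler_sum => i _.
have id : (i <= d.-1)%N by case: d i => [[]//|d' i]; exact: (ltn_ord i).
by rewrite -[in leRHS](subnKC id) exprD ler_wpM2l ?exprn_ge0// lerXn2r// nnegrE.
Qed.

(** Only the last summand is free of the factor [y]. The case [y = 0] arises when a queue length is
    supposed to vanish. *)
Lemma Pd_0r (R : realType) d (x : R) : (0 < d)%N -> Pd d x 0 = x ^+ d.-1.
Proof.
case: d => // d _; rewrite /Pd/= big_ord_recr/= subnn expr0 mulr1 big1 ?add0r//.
by move=> i _; rewrite expr0n subn_eq0 leqNgt ltn_ord mulr0.
Qed.

Definition aged_mass {R : realType} (G : R -> R) (nu : mseq R) (l : nat) (t : R) : R :=
  pairing G (aged G (fun=> 1) t) (nu l).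

(** In a constant state departures grow linearly in time, so their amount over unit time is the rate
    [<h, nu_l>], made real by [fine]. *)
Definition departure_rate {R : realType} (G g : R -> R) (nu : mseq R) (l : nat) : R :=
  fine (departures G g (fun=> nu) l 1).

(** For [l >= 2], [eta_l] is this factor times [nu_(l-1) - nu_l]. *)
Definition routing_rate {R : realType} (G : R -> R) (d : nat) (lambda : R)
    (nu : mseq R) (l : nat) : R :=
  lambda * Pd d (queue_length G nu l.-1) (queue_length G nu l).

(** * Balance relations in an invariant state *)

Section invariant_state.
Variables (R : realType) (G g : R -> R) (d : nat) (lambda : R) (nu : mseq R).
Hypothesis GS : service_distribution G g.
Hypothesis d0 : (0 < d)%N.
Hypothesis lambda0 : 0 < lambda.
Hypothesis nuI : invariant_state G g d lambda nu.
Implicit Types (t u : R) (l : nat).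

Local Notation s := (queue_length G nu).
Local Notation a := (aged_mass G nu).
Local Notation H := (departure_rate G g nu).
Local Notation c := (routing_rate G d lambda nu).

Lemma queue_length_noninc l : (0 < l)%N -> s l.+1 <= s l.
Proof.
move=> l0; have [[_ nuS] _] := nuI.
by apply: nuS => //; exact: cst_Cb.
Qed.

Lemma aged_mass_le l t : 0 <= t -> (0 < l)%N -> a l.+1 t <= a l t.
Proof.
rewrite le_eqVlt => /predU1P[<-|t0] l0.
  (* [A_0] may jump from 1 to 0 at the end of [supp G], so it need not be a test function; on
     [supp G] it is 1. *)
  have aE k : a k 0 = s k.
    apply: eq_Rintegral => x; rewrite inE => Gx.
    by rewrite /aged addr0 mul1r divff// gt_eqF// (supp_Gbar _ _ _ GS).
  by rewrite !aE queue_length_noninc.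
have [[_ nuS] _] := nuI.
apply: nuS => //; first exact: (aged1_Cb _ _ _ GS).
by move=> x _; exact: (aged1_ge0 _ _ _ GS).
Qed.

Lemma aged_mass_le1 l t : 0 <= t -> (0 < l)%N -> a l t <= a 1 t.
Proof.
move=> t0; elim: l => // -[//|l] IH _.
by apply: le_trans (IH isT); exact: aged_mass_le.
Qed.

(** The mass equation at time 1, whose left side is 0 in a constant state. *)
Lemma departure_rate_step l : (0 < l)%N ->
  H l = H l.+1 + pair_eta G d lambda nu l (fun=> 1).
Proof.
move=> l0; have [_ [_ _ _ nuM _]] := nuI.
rewrite /departure_rate; have /eqP := nuM l l0 1 ler01.
rewrite subrr eq_sym subr_eq0 => /eqP <-.
rewrite Rintegral_cst// [X in _ * fine X](_ : _ = 1%:E)%E ?mulr1//.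
exact: (lebesgue_measure_itv0 _ _ ler01).
Qed.

(** By [Pd_subX] the flow into level [l + 1] is [lambda (s_l^d - s_(l+1)^d)], so the step identity
    telescopes. *)
Lemma departure_rate_cst l : (0 < l)%N ->
  H l.+1 - lambda * s l ^+ d = H 2 - lambda * s 1 ^+ d.
Proof.
elim: l => // -[//|l] IH _; rewrite -(IH isT).
rewrite [H l.+2](departure_rate_step l.+2)// /pair_eta/= -mulrA Pd_subX//.
rewrite -/(s l.+1) -/(s l.+2).
ring.
Qed.

(** In a constant state [dD_(l+1)] is [H_(l+1) du], so the renewal equation writes the difference as
    two integrals over a window of length [t], and pointwise bounds on the integrands suffice. The
    balance estimates below come from choices of [f]. *)
Lemma hydro_bounds l t (f : R -> R) (m1 M1 m2 M2 : R) :
  (0 < l)%N -> 0 <= t -> Cb `[0, +oo[%classic f ->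
  measurable_fun `[0%R, t]%classic (fun u => f (t - u) * Gbar G (t - u)) ->
  measurable_fun `[0%R, t]%classic
    (fun u => pair_eta G d lambda nu l (aged G f (t - u))) ->
  (forall u, 0 <= u <= t -> m1 <= f u * Gbar G u <= M1) ->
  (forall u, 0 <= u <= t -> m2 <= pair_eta G d lambda nu l (aged G f u) <= M2) ->
  t * (m1 * H l.+1 + m2) <=
    pairing G f (nu l) - pairing G (aged G f t) (nu l)
    <= t * (M1 * H l.+1 + M2).
Proof.
move=> l0 t0 fC mf me f1 f2; have [_ [_ _ _ _ /(_ _ l0)[F [FE nuE]]]] := nuI.
have FH u : F u = Num.max u 0 * H l.+1.
  by rewrite FE; apply: (departures_cst _ _ g); rewrite le_max lexx orbT.
have tu u : `[0%R, t]%classic u -> 0 <= t - u <= t.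
  by rewrite /= in_itv/= => /andP[u0 ut]; rewrite subr_ge0 ut gerBl.
rewrite (nuE t t0 f fC).
have -> (x y z : R) : x + y + z - x = y + z by ring.
have mF := lebesgue_stieltjes_pos_part _ _ _ FH _ t0.
have mL := lebesgue_measure_itv0 _ _ t0.
have /andP[A1 A2] : m1 * (t * H l.+1) <=
    \int[lebesgue_stieltjes_measure F]_(s in `[0%R, t]) (f (t - s) * Gbar G (t - s))
    <= M1 * (t * H l.+1).
  rewrite -[t * H l.+1]/(fine (t * H l.+1)%:E) -mF; apply: Rintegral_bounds => //.
    by have := ltry (t * H l.+1); rewrite -mF.
  by move=> u /tu; exact: f1.
have /andP[B1 B2] : m2 * t <=
    \int[@lebesgue_measure R]_(s in `[0%R, t]) pair_eta G d lambda nu l (aged G f (t - s))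
    <= M2 * t.
  rewrite -[X in X <= _]/(m2 * fine t%:E) -[X in _ <= _ <= X]/(M2 * fine t%:E).
  rewrite -mL; apply: Rintegral_bounds => //.
    by have := ltry t; rewrite -mL.
  by move=> u /tu; exact: f2.
have E k1 k2 : t * (k1 * H l.+1 + k2) = k1 * (t * H l.+1) + k2 * t by ring.
rewrite !E.
by apply/andP; split; apply: lerD.
Qed.

Lemma routing_rate_ge0 l : 0 <= c l.
Proof. rewrite /routing_rate mulr_ge0 ?(ltW lambda0)// Pd_ge0//; exact: mass_ge0. Qed.

Lemma measurable_Gbar_flip t :
  measurable_fun `[0%R, t]%classic (fun u => Gbar G (t - u)).
Proof.
apply: nondecreasing_measurable => // u v uv.
by apply: (Gbar_noninc _ _ _ GS); rewrite lerB.
Qed.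

(** The choice [f = 1]. For [0 <= u <= t], [Gbar G u] lies between [Gbar G t] and 1, and
    [a_(l-1)(u) - a_l(u)] is at most [s_(l-1)] and, by monotonicity in [l] and in [u], at least 0
    and at least [a_(l-1)(t) - s_l]. The lower bound controls [H] and gives positivity; the upper
    one drives the recursion. *)
Lemma aged_mass_balance l t : (1 < l)%N -> 0 <= t ->
  t * (Gbar G t * H l.+1 + c l * Num.max 0 (a l.-1 t - s l)) <= s l - a l t
  <= t * (H l.+1 + c l * s l.-1).
Proof.
move=> l1 t0; rewrite -[in X in _ <= _ <= X](mul1r (H _)).
have eE f : pair_eta G d lambda nu l f =
    c l * (pairing G f (nu l.-1) - pairing G f (nu l)).
  by rewrite /pair_eta leqNgt l1.
apply: hydro_bounds => //.
- exact: (ltnW l1).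
- exact: cst_Cb.
- by apply: eq_measurable_fun (measurable_Gbar_flip t) => u _; rewrite mul1r.
- apply: (eq_measurable_fun (fun u => c l * (a l.-1 (t - u) - a l (t - u)))) => [u _|].
    by rewrite eE.
  by apply: measurable_funM => //; apply: measurable_funB;
    exact: (pairing_aged1_measurable _ _ _ GS).
- move=> u /andP[u0 ut]; rewrite /= mul1r (Gbar_le1 _ _ _ GS) andbT.
  exact: (Gbar_noninc _ _ _ GS).
- move=> u /andP[u0 ut]; rewrite eE.
  have /andP[A0 As] := pairing_aged1_bounds _ _ _ GS (nu l) _ u0.
  have /andP[B0 Bs] := pairing_aged1_bounds _ _ _ GS (nu l.-1) _ u0.
  apply/andP; split; last first.
    by rewrite ler_wpM2l ?routing_rate_ge0// lerBlDr ler_wpDr.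
  rewrite ler_wpM2l ?routing_rate_ge0// ge_max; apply/andP; split.
    rewrite subr_ge0; case: l l1 {eE A0 As B0 Bs} => // l l1.
    exact: aged_mass_le.
  by apply: lerB => //; exact: (pairing_aged1_noninc _ _ _ GS).
Qed.

(** Again [f = 1]. At level 1 the arrivals [eta_1] sit at age 0, where [A_u] equals [Gbar G u], so
    both contributions carry the same factor. *)
Lemma aged_mass_balance1 t : 0 <= t ->
  t * (Gbar G t * (H 2 + lambda * (1 - s 1 ^+ d))) <= s 1 - a 1 t
  <= t * (H 2 + lambda * (1 - s 1 ^+ d)).
Proof.
move=> t0; have eE f : pair_eta G d lambda nu 1 f = lambda * (1 - s 1 ^+ d) * f 0 by [].
have e0 : 0 <= lambda * (1 - s 1 ^+ d).
  by rewrite mulr_ge0 ?(ltW lambda0)// subr_ge0 exprn_ile1 ?mass_ge0 ?mass_le1.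
rewrite mulrDr -[in X in _ <= _ <= X](mul1r (H _)).
have AE u : aged G (fun=> 1) u 0 = Gbar G u.
  by rewrite /aged (Gbar0 _ _ _ GS) divr1 mul1r add0r.
apply: hydro_bounds => //.
- exact: cst_Cb.
- by apply: eq_measurable_fun (measurable_Gbar_flip t) => u _; rewrite mul1r.
- apply: (eq_measurable_fun (fun u => lambda * (1 - s 1 ^+ d) * Gbar G (t - u))) => [u _|].
    by rewrite eE AE.
  by apply: measurable_funM => //; exact: measurable_Gbar_flip.
- move=> u /andP[u0 ut]; rewrite /= mul1r (Gbar_le1 _ _ _ GS) andbT.
  exact: (Gbar_noninc _ _ _ GS).
- move=> u /andP[u0 ut]; rewrite eE AE; apply/andP; split.
    by rewrite mulrC ler_wpM2l//; exact: (Gbar_noninc _ _ _ GS).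
  by rewrite ler_piMr// (Gbar_le1 _ _ _ GS).
Qed.

(** The choice [f = A_t]. By the semigroup law its aged version is [A_(2t)], and both integrands
    carry [Gbar G (u + t) <= Gbar G t], which brings in the tail of the service distribution. *)
Lemma aged_mass_halving t : 0 < t ->
  a 1 t <= a 1 (2 * t) + t * (Gbar G t * (H 2 + lambda * (1 - s 1 ^+ d))).
Proof.
move=> t0; have eE f : pair_eta G d lambda nu 1 f = lambda * (1 - s 1 ^+ d) * f 0 by [].
have e0 : 0 <= lambda * (1 - s 1 ^+ d).
  by rewrite mulr_ge0 ?(ltW lambda0)// subr_ge0 exprn_ile1 ?mass_ge0 ?mass_le1.
have AE u : 0 <= u -> aged G (aged G (fun=> 1) t) u 0 = Gbar G (u + t).
  move=> u0; rewrite (aged_aged1 _ _ _ GS) ?(ltW t0)//.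
  by rewrite /aged (Gbar0 _ _ _ GS) divr1 mul1r add0r.
have AG u : 0 <= u -> aged G (fun=> 1) t u * Gbar G u = Gbar G (u + t).
  by move=> u0; rewrite -AE// /aged !mul1r add0r (Gbar0 _ _ _ GS) divr1.
have -> : a 1 (2 * t) = pairing G (aged G (aged G (fun=> 1) t) t) (nu 1).
  apply: eq_Rintegral => x _; rewrite (aged_aged1 _ _ _ GS) ?(ltW t0)//.
  by rewrite mulrDl !mul1r.
rewrite addrC -lerBlDr mulrDr.
have mflip : measurable_fun `[0%R, t]%classic (fun u => Gbar G (t - u + t)).
  apply: nondecreasing_measurable => // u v uv.
  by apply: (Gbar_noninc _ _ _ GS); rewrite lerD2r lerB.
have t_ u : u \in `[0%R, t]%classic -> 0 <= t - u.
  by rewrite inE/= in_itv/= => /andP[_]; rewrite subr_ge0.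
have Gt u : 0 <= u -> Gbar G (u + t) <= Gbar G t.
  by move=> u0; apply: (Gbar_noninc _ _ _ GS); rewrite lerDr.
have /andP[_] // : t * (0 * H 2 + 0) <=
    pairing G (aged G (fun=> 1) t) (nu 1)
    - pairing G (aged G (aged G (fun=> 1) t) t) (nu 1)
  <= t * (Gbar G t * H 2 + Gbar G t * (lambda * (1 - s 1 ^+ d))).
apply: hydro_bounds => //.
- exact: ltW.
- exact: (aged1_Cb _ _ _ GS).
- apply: eq_measurable_fun mflip => u ut; rewrite AG//; exact: t_.
- apply: (eq_measurable_fun (fun u =>
    lambda * (1 - s 1 ^+ d) * Gbar G (t - u + t))) => [u ut|].
    by rewrite eE AE//; exact: t_.
  exact: measurable_funM.
- by move=> u /andP[u0 ut]; rewrite AG// Gt// (Gbar_ge0 _ _ _ GS).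
- move=> u /andP[u0 ut]; rewrite eE AE// mulr_ge0 ?(Gbar_ge0 _ _ _ GS)//=.
  by rewrite mulrC ler_wpM2r// Gt.
Qed.

End invariant_state.

(** * Physical invariant states: departure rates, positivity and decay of the aged mass *)

Section physical_state.
Variables (R : realType) (G g : R -> R) (d : nat) (lambda : R) (nu : mseq R).
Hypothesis GS : service_distribution G g.
Hypothesis d0 : (0 < d)%N.
Hypothesis lambda0 : 0 < lambda.
Hypothesis nuP : physical_invariant_state G g d lambda nu.
Implicit Types (t u : R) (l : nat).

Local Notation s := (queue_length G nu).
Local Notation a := (aged_mass G nu).
Local Notation H := (departure_rate G g nu).
Local Notation c := (routing_rate G d lambda nu).

Let nuI := nuP.1.

Let s_ge0 l : 0 <= s l. Proof. exact: mass_ge0. Qed.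
Let s_le1 l : s l <= 1. Proof. exact: mass_le1. Qed.
Let H_ge0 l : 0 <= H l. Proof. exact: (departures_ge0 _ _ _ GS). Qed.
Let a_ge0 l t : 0 <= t -> 0 <= a l t.
Proof. by move=> t0; have /andP[] := pairing_aged1_bounds _ _ _ GS (nu l) _ t0. Qed.
Let rate1_ge0 : 0 <= H 2 + lambda * (1 - s 1 ^+ d).
Proof.
by rewrite addr_ge0// mulr_ge0 ?(ltW lambda0)// subr_ge0 exprn_ile1.
Qed.

Lemma Gbar_pos_near0 : exists2 t, 0 < t & 0 < Gbar G t.
Proof.
have /cvgrPdist_lt/(_ _ ltr01)[e /= e0 eG] := Gbar_continuous _ _ _ GS 0.
exists (e / 2); first by rewrite divr_gt0.
have := eG (e / 2); rewrite (Gbar0 _ _ _ GS) /= sub0r normrN gtr0_norm ?divr_gt0//.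
rewrite ltr_pdivrMr// ltr_pMr// ltr1n => /(_ isT).
by rewrite ltr_norml => /andP[_]; rewrite ltrBlDr ltrDl.
Qed.

(** The lower balance without its routing term and with [a_l(t) >= 0]. For fixed [t] with
    [Gbar G t > 0] it makes [H_(l+1)] vanish along with [s_l]. *)
Lemma departure_rate_le l t : (1 < l)%N -> 0 <= t ->
  t * (Gbar G t * H l.+1) <= s l.
Proof.
move=> l1 t0.
have /andP[lo _] := aged_mass_balance _ _ _ _ _ _ GS lambda0 nuI _ _ l1 t0.
have at0 := a_ge0 l _ t0.
have sl : s l - a l t <= s l by rewrite gerBl.
apply: le_trans sl; apply: le_trans lo.
rewrite ler_wpM2l// lerDl mulr_ge0//; last by rewrite le_max lexx.
exact: routing_rate_ge0.
Qed.

(* The difference of the two sides does not depend on [l], by telescoping, and both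
   sides vanish as [l] grows. *)
Lemma departure_rateE l : (0 < l)%N -> H l.+1 = lambda * s l ^+ d.
Proof.
move=> l0; apply/eqP; rewrite -subr_eq0.
rewrite (departure_rate_cst _ _ _ _ _ _ d0 nuI)//.
set k := (X in X == 0).
have [t t0 Gt] := Gbar_pos_near0.
(* The first summand comes from [departure_rate_le], whose condition [1 < l] explains the index
   [m.+2]; the second comes from [s ^+ d <= s]. *)
pose C := (t * Gbar G t)^-1 + lambda.
have kC m : `|k| <= C * s m.+2.
  rewrite /k -(departure_rate_cst _ _ _ _ _ _ d0 nuI m.+2)//.
  rewrite (le_trans (ler_normB _ _))// ger0_norm// ger0_norm; last first.
    by rewrite mulr_ge0 ?(ltW lambda0)// exprn_ge0.
  rewrite mulrDl lerD//.
    rewrite mulrC ler_pdivlMr ?mulr_gt0// mulrC -mulrA.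
    by apply: departure_rate_le => //; exact: ltW.
  rewrite ler_wpM2l ?(ltW lambda0)//.
  by rewrite -{2}[s m.+2]expr1 ler_wiXn2l.
have Cs : C * s m.+2 @[m --> \oo] --> C * 0.
  apply: cvgM; first exact: cvg_cst.
  have := nuP.2; rewrite -(cvg_shiftn 2); apply: cvg_trans.
  by apply: near_eq_cvg; apply: nearW => m /=; rewrite addn2.
rewrite mulr0 in Cs.
rewrite -normr_le0 -(cvg_lim _ Cs)//.
by apply: limr_ge; [exact: cvgP Cs|exact: nearW].
Qed.

(** The upper balance for [l + 1]: in [1 + d], the 1 stems from [H_(l+2) = lambda s_(l+1)^d <=
    lambda s_l^d] and the [d] from [c_(l+1) <= lambda d s_l^(d-1)]. *)
Lemma queue_length_step l t : (0 < l)%N -> 0 <= t ->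
  s l.+1 <= a 1 t + t * ((1 + d%:R) * lambda * s l ^+ d).
Proof.
move=> l0 t0.
have /andP[_] := aged_mass_balance _ _ _ _ _ _ GS lambda0 nuI l.+1 _ l0 t0.
rewrite lerBlDl => /le_trans; apply; apply: lerD.
  exact: (aged_mass_le1 _ _ _ _ _ _ GS nuI).
have ss := queue_length_noninc _ _ _ _ _ _ nuI _ l0.
rewrite ler_wpM2l// departure_rateE//= -mulrA mulrDl mul1r lerD//.
  by rewrite ler_wpM2l ?(ltW lambda0)// lerXn2r// nnegrE.
rewrite /routing_rate/= [leRHS]mulrCA -mulrA ler_wpM2l ?(ltW lambda0)//.
by rewrite -(prednK d0) exprSr mulrA ler_wpM2r// prednK// Pd_le.
Qed.

(* If [s_(l+1) = 0], the balance for [l + 1] forces [a_l(u) <= 0] for every [u > 0],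
   whereas [a_l(u)] is close to [s_l] for small [u]. *)
Lemma queue_length_gt0 l : (0 < l)%N -> 0 < s l.
Proof.
have [t t0 Gt] := Gbar_pos_near0.
have step k K : (forall u, 0 < u -> s k <= a k u + u * K) ->
  0 < s k -> exists2 u, 0 < u & 0 < a k u.
  (* This [u] makes [u * K] smaller than [s k], which leaves a positive aged mass. *)
  move=> kK sk; pose u := s k / (`|K| + 1).
  have K1 : 0 < `|K| + 1 by rewrite ltr_wpDl.
  have u0 : 0 < u by rewrite divr_gt0.
  exists u => //; have := kK _ u0; rewrite -lerBlDr; apply: lt_le_trans.
  rewrite subr_gt0 (le_lt_trans (ler_norm _))// normrM gtr0_norm//.
  by rewrite /u mulrAC ltr_pdivrMr// ltr_pM2l// ltrDl.
elim: l => // -[_ _|l IH _].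
  (* If [s 1 = 0], the arrivals at age 0 have the full rate [lambda], against the lower balance. *)
  rewrite lt_def s_ge0 andbT; apply/eqP => s1.
  have /andP[lo _] := aged_mass_balance1 _ _ _ _ _ _ GS lambda0 nuI _ (ltW t0).
  have at0 := a_ge0 1 _ (ltW t0).
  move: lo; rewrite s1 expr0n gtn_eqF// subr0 mulr1 sub0r => lo.
  have : t * (Gbar G t * (H 2 + lambda)) <= 0 by rewrite (le_trans lo)// oppr_le0.
  by rewrite leNgt !mulr_gt0// ltr_wpDl.
have {IH} sl := IH isT.
rewrite lt_def s_ge0 andbT; apply/eqP => s0.
have [u u0 au] : exists2 u, 0 < u & 0 < a l.+1 u.
  case: l sl {s0} => [|l] sl.
    apply: (step 1%N (H 2 + lambda * (1 - s 1 ^+ d))) => // u u0.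
    rewrite -lerBlDl.
    by have /andP[] := aged_mass_balance1 _ _ _ _ _ _ GS lambda0 nuI _ (ltW u0).
  apply: (step l.+2 (H l.+3 + c l.+2 * s l.+1)) => // u u0.
  rewrite -lerBlDl.
  by have /andP[] := aged_mass_balance _ _ _ _ _ _ GS lambda0 nuI l.+2 _ isT (ltW u0).
have /andP[lo _] := aged_mass_balance _ _ _ _ _ _ GS lambda0 nuI l.+2 _ isT (ltW u0).
have at0 := a_ge0 l.+2 _ (ltW u0).
move: lo; rewrite s0/= subr0 sub0r max_r ?(ltW au)// => lo.
have : u * (Gbar G u * H l.+3 + c l.+2 * a l.+1 u) <= 0.
  by rewrite (le_trans lo)// oppr_le0.
rewrite leNgt; apply/negP; rewrite negbK mulr_gt0// ltr_wpDl//.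
  by rewrite mulr_ge0// (Gbar_ge0 _ _ _ GS).
(* With [s l.+2 = 0] the routing rate is [lambda * s l.+1 ^+ d.-1], positive by induction. *)
by rewrite mulr_gt0// /routing_rate/= s0 Pd_0r// mulr_gt0// exprn_gt0.
Qed.

Lemma aged_mass_tail (beta x0 C0 : R) : 1 < beta -> 0 < x0 ->
  (forall x : R, x0 <= x -> Gbar G x <= C0 * x `^ (- beta)) ->
  exists2 K, 0 <= K & forall t, x0 <= t -> a 1 t <= K * t `^ (1 - beta).
Proof.
move=> b1 x00 tail; set h := H 2 + lambda * (1 - s 1 ^+ d).
have C00 : 0 <= C0.
  have := le_trans (Gbar_ge0 _ _ _ GS x0) (tail _ (lexx _)).
  by rewrite pmulr_lge0// powR_gt0.
have two0 : 0 < 1 - (2 : R) `^ (1 - beta).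
  by rewrite subr_gt0 -[ltRHS]expR0 /powR gt_eqF// ltr_expR nmulr_rlt0 ?subr_lt0//
    ln_gt0 ?ltr1n.
(* Chosen so that the halving error, at most [h C0 u^(1 - beta)], is at most
   [K (u^(1 - beta) - (2u)^(1 - beta))]; the errors then telescope along dyadic times. *)
pose K := h * C0 / (1 - 2 `^ (1 - beta)).
have K0 : 0 <= K by rewrite divr_ge0 ?(ltW two0)// mulr_ge0.
exists K => // t x0t; have t0 : 0 < t by exact: lt_le_trans x0t.
have half u : x0 <= u ->
    a 1 u <= a 1 (2 * u) + K * (u `^ (1 - beta) - (2 * u) `^ (1 - beta)).
  move=> x0u; have u0 : 0 < u by exact: lt_le_trans x0u.
  apply: le_trans (aged_mass_halving _ _ _ _ _ _ GS lambda0 nuI _ u0) _.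
  rewrite lerD2l -/h powRM ?(ltW u0)//.
  have -> : K * (u `^ (1 - beta) - 2 `^ (1 - beta) * u `^ (1 - beta)) =
      h * C0 * u `^ (1 - beta).
    by rewrite -{1}[u `^ _]mul1r -mulrBl mulrA divfK// gt_eqF.
  rewrite powRD ?(gt_eqF u0) ?implybT// powRr1 ?(ltW u0)//.
  rewrite [leRHS](_ : _ = u * (C0 * u `^ (- beta) * h)); last by ring.
  by rewrite ler_pM2l// ler_wpM2r// tail.
have iter_half n : a 1 t <= a 1 (2 ^+ n * t)
    + K * (t `^ (1 - beta) - (2 ^+ n * t) `^ (1 - beta)).
  elim: n => [|n IH]; first by rewrite expr0 mul1r subrr mulr0 addr0.
  have n2 : (1 : R) <= 2 ^+ n by rewrite exprn_ege1// ler1n.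
  have := half (2 ^+ n * t); rewrite mulrA -exprS => /(_ _).
  rewrite (le_trans x0t) ?ler_peMl ?(ltW t0)// => /(_ isT) Hn.
  apply: le_trans IH _; rewrite -lerBrDr; apply: le_trans Hn _.
  by rewrite le_eqVlt; apply/orP; left; apply/eqP; ring.
have le_n n : a 1 t <= a 1 (2 ^+ n * t) + K * t `^ (1 - beta).
  by rewrite (le_trans (iter_half n))// lerD2l ler_wpM2l// gerBl powR_ge0.
have cn : a 1 (2 ^+ n * t) + K * t `^ (1 - beta) @[n --> \oo] -->
    0 + K * t `^ (1 - beta).
  apply: cvgD; last exact: cvg_cst.
  exact: (pairing_aged1_cvg0 _ _ _ GS).
rewrite add0r in cn; rewrite -(cvg_lim _ cn)//.
by apply: limr_ge; [exact: cvgP cn|exact: nearW].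
Qed.

End physical_state.

(** * From the recursion to the doubly exponential decay *)

Lemma queue_length_recursion (R : realType) (G g : R -> R) (d : nat)
    (lambda : R) (nu : mseq R) (beta x0 C0 : R) :
  service_distribution G g -> (0 < d)%N -> 0 < lambda ->
  physical_invariant_state G g d lambda nu -> 1 < beta -> 0 < x0 ->
  (forall x : R, x0 <= x -> Gbar G x <= C0 * x `^ (- beta)) ->
  exists2 x1, 0 < x1 & exists K, forall l, (0 < l)%N ->
    queue_length G nu l <= x1 ->
    queue_length G nu l.+1 <= K * queue_length G nu l `^ (d%:R - d%:R / beta).
Proof.
move=> GS d0 lambda0 nuP b1 x00 tail.
have [K K0 aK] := aged_mass_tail _ _ _ _ _ _ GS lambda0 nuP _ _ _ b1 x00 tail.
have b0 : 0 < beta by rewrite (lt_trans ltr01).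
pose q : R := d%:R / beta; have q0 : 0 < q by rewrite divr_gt0// ltr0n.
(* This threshold solves [x1^(-q) = x0], so [s <= x1] puts the time [t = s^(-q)] in the range of the
   tail bound. *)
exists (x0 `^ (- q^-1)); first exact: powR_gt0.
(* At [t = s^(-q)] both [t^(1 - beta)] and [t s^d] equal [s^(d - q)], so the two constants add
   up. *)
exists (K + (1 + d%:R) * lambda) => l l0.
have s0 := queue_length_gt0 _ _ _ _ _ _ GS d0 lambda0 nuP _ l0.
set s := queue_length G nu l in s0 *; move=> sx.
have x0t : x0 <= s `^ (- q).
  have : s `^ q <= (x0 `^ (- q^-1)) `^ q.
    by apply: ge0_ler_powR; rewrite ?nnegrE ?powR_ge0// ltW.
  rewrite -powRrM mulNr mulVf ?gt_eqF// powR_inv1 ?(ltW x00)// powRN.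
  by move=> sq; rewrite -[x0]invrK lef_pV2 ?posrE ?invr_gt0 ?powR_gt0.
have t0 : 0 <= s `^ (- q) by exact: powR_ge0.
apply: le_trans (queue_length_step _ _ _ _ _ _ GS d0 lambda0 nuP _ _ l0 t0) _.
rewrite [leRHS]mulrDl lerD//.
  apply: le_trans (aK _ x0t) _; rewrite -powRrM.
  suff -> : - q * (1 - beta) = d%:R - q by [].
  by rewrite /q; field; rewrite gt_eqF.
rewrite -/s mulrCA -(powR_mulrn d (ltW s0)) -powRD ?(gt_eqF s0) ?implybT//.
by rewrite [- q + _]addrC.
Qed.

(** For [y = ln (1 / s)] the recursion becomes [y_(l+1) >= kappa y_l - k]; the excess of [y] over
    the fixed point [k / (kappa - 1)] is then multiplied by at least [kappa] at each step. *)
Lemma doubly_exponential_growth (R : realType) (s : nat -> R) (K kappa x1 : R) :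
  1 < kappa -> 0 < x1 -> (forall l, (0 < l)%N -> 0 < s l) ->
  s l @[l --> \oo] --> 0 ->
  (forall l, (0 < l)%N -> s l <= x1 -> s l.+1 <= K * s l `^ kappa) ->
  exists N, forall m, kappa ^+ m <= ln (1 / s (N + m)%N).
Proof.
move=> k1 x10 s0 s_cvg rec.
pose K1 := Num.max K 1; pose k := ln K1.
have K1ge1 : 1 <= K1 by rewrite le_max lexx orbT.
have k0 : 0 <= k by rewrite ln_ge0.
have km0 : 0 < kappa - 1 by rewrite subr_gt0.
(* Once [s] is below [e], the recursion applies and [y] exceeds its fixed point by at least 1, which
   starts the induction. *)
pose e := Num.min x1 (expR (- (k / (kappa - 1) + 1))).
have e0 : 0 < e by rewrite lt_min x10 expR_gt0.
have /cvgrPdist_le/(_ _ e0)[N0 _ sN] := s_cvg.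
have {sN} se l : (N0 < l)%N -> s l <= e.
  move=> Nl; have := sN l (ltnW Nl); rewrite /= sub0r normrN.
  exact: le_trans (ler_norm _).
pose N := N0.+1; exists N; pose y l := ln (1 / s l).
have yE l : (0 < l)%N -> y l = - ln (s l).
  by move=> l0; rewrite /y div1r lnV// posrE s0.
suff yk m : kappa ^+ m <= y (N + m)%N - k / (kappa - 1).
  by move=> m; rewrite (le_trans (yk m))// gerBl divr_ge0// ltW.
elim: m => [|m IH].
  rewrite addn0 expr0 lerBrDr yE// lerNr -(expRK (- _)) ler_ln ?posrE ?expR_gt0 ?s0//.
  by rewrite (le_trans (se N _))// ge_min addrC lexx orbT.
rewrite addnS; set l := (N + m)%N in IH *.
have l0 : (0 < l)%N by [].
have Nl : (N0 < l)%N by rewrite leq_addr.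
have step : kappa * y l - k <= y l.+1.
  have sx : s l <= x1 by rewrite (le_trans (se _ Nl))// ge_min lexx.
  have sk : s l.+1 <= K1 * s l `^ kappa.
    by rewrite (le_trans (rec l l0 sx))// ler_wpM2r ?powR_ge0// le_max lexx.
  rewrite !yE// mulrN -opprD lerN2 addrC /k -ln_powR -lnM ?posrE ?powR_gt0 ?s0//; last first.
    by rewrite (lt_le_trans _ K1ge1).
  by rewrite ler_ln ?posrE ?s0// mulr_gt0 ?powR_gt0 ?s0// (lt_le_trans _ K1ge1).
apply: (@le_trans _ _ (kappa * (y l - k / (kappa - 1)))).
  by rewrite exprS ler_wpM2l// (le_trans ler01)// ltW.
rewrite lerBrDr; apply: le_trans step.
rewrite le_eqVlt; apply/orP; left; apply/eqP; field.
by rewrite gt_eqF.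
Qed.

(** Taking logarithms twice, the sequence is at least [n_d (l - N) / l = n_d - n_d N / l] for large
    [l]. *)
Lemma limn_einf_doubly_exponential (R : realType) (b kappa : R) (y : nat -> R) (N : nat) :
  1 < b -> 1 < kappa -> (forall m, kappa ^+ m <= y (N + m)%N) ->
  ((ln kappa / ln b)%:E <=
     limn_einf (fun l : nat => (l%:R^-1 * logb b (y l))%:E))%E.
Proof.
move=> b1 k1 yk; have lb : 0 < ln b by rewrite ln_gt0.
have lk : 0 < ln kappa by rewrite ln_gt0.
set n_d := ln kappa / ln b; have n0 : 0 < n_d by rewrite divr_gt0.
have k0 : 0 < kappa by rewrite (lt_trans ltr01).
apply/lee_subgt0Pr => e e0.
(* For [l >= M] the error [n_d N / l] is at most [e]; moreover [l - N] is a true subtraction and the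
   successor keeps [l] positive. *)
pose M := maxn N (Num.bound (n_d * N%:R / e)).+1.
rewrite limn_einf_lim; apply: lime_ge; first exact: is_cvg_einfs.
exists M => // n /= Mn.
apply: le_ereal_inf_tmp => _ [l /= nl <-].
have Ml := leq_trans Mn nl.
have Nl : (N <= l)%N by rewrite (leq_trans _ Ml)// leq_maxl.
have l0 : (0 < l)%N by rewrite (leq_trans _ Ml)// leq_max orbT.
have lR : (0 : R) < l%:R by rewrite ltr0n.
have := yk (l - N)%N; rewrite subnKC// => yl.
have ly : (l - N)%:R * ln kappa <= ln (y l).
  rewrite mulr_natl -lnXn// ler_ln ?posrE ?exprn_gt0//.
  by rewrite (lt_le_trans _ yl)// exprn_gt0.
rewrite -EFinB lee_fin.
apply: (@le_trans _ _ (l%:R^-1 * ((l - N)%:R * n_d))); last first.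
  rewrite ler_wpM2l ?invr_ge0 ?(ltW lR)//.
  by rewrite /logb ler_pdivlMr// /n_d mulrA divfK// gt_eqF.
have -> : l%:R^-1 * ((l - N)%:R * n_d) = n_d - n_d * N%:R / l%:R.
  by rewrite natrB//; field; rewrite gt_eqF.
rewrite lerD2l lerN2 ler_pdivrMr// [leRHS]mulrC -ler_pdivrMr//.
have /ltW/le_trans := archi_boundP (divr_ge0 (mulr_ge0 (ltW n0) (ler0n _ N)) (ltW e0)).
by apply; rewrite ler_nat (leq_trans _ Ml)// leq_max leqnSn orbT.
Qed.

Theorem theorem3p7 (R : realType) (d : nat) (beta : R)
    (hd : (2 <= d)%N) (hbeta : d%:R / (d%:R - 1) < beta) :
  exists2 n_d : R, 0 < n_d &
    forall (lambda : R) (G g : R -> R) (x0 C0 : R) (nu : mseq R),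
      0 < lambda -> lambda < 1 ->
      service_distribution G g ->
      hydro_well_posed G g d lambda ->
      1 / (lambda * d%:R) < x0 ->
      (forall x : R, x0 <= x -> Gbar G x <= C0 * x `^ (- beta)) ->
      physical_invariant_state G g d lambda nu ->
      (n_d%:E <= limn_einf (fun l : nat =>
         (l%:R^-1 * logb d%:R (ln (1 / queue_length G nu l)))%:E))%E.
Proof.
have d0 : (0 < d)%N by exact: ltnW.
have d1 : (1 : R) < d%:R by rewrite ltr1n.
have d10 : (0 : R) < d%:R - 1 by rewrite subr_gt0.
have bd : d%:R < beta * (d%:R - 1) by rewrite -ltr_pdivrMr.
have b1 : 1 < beta.
  by rewrite (le_lt_trans _ hbeta)// ler_pdivlMr// mul1r gerBl.
have b0 : 0 < beta by rewrite (lt_trans ltr01).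
pose kappa : R := d%:R - d%:R / beta.
have k1 : 1 < kappa.
  rewrite /kappa ltrBrDr addrC -ltrBrDr ltr_pdivrMr// mulrC; lra.
(* [kappa] involves only [d] and [beta], so this constant is fixed before [lambda], [G] and the
   state. *)
exists (ln kappa / ln d%:R); first by rewrite divr_gt0// ln_gt0.
move=> lambda G g x0 C0 nu lambda0 _ GS _ x0l tail nuP.
have x00 : 0 < x0.
  by rewrite (lt_trans _ x0l)// divr_gt0// mulr_gt0// ltr0n.
have [x1 x10 [K rec]] :=
  queue_length_recursion _ _ _ _ _ _ _ _ _ GS d0 lambda0 nuP b1 x00 tail.
have [N yN] := doubly_exponential_growth _ _ _ _ _ k1 x10
  (queue_length_gt0 _ _ _ _ _ _ GS d0 lambda0 nuP) nuP.2 rec.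
exact: limn_einf_doubly_exponential yN.
Qed.
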